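(* Let $T\subseteq\omega^{<\omega_1}$ be an Aronszajn tree. Let $\{A_\sigma:\sigma\in T\}\subseteq[\omega]^\omega$ be such that $A_\tau\subseteq^* A_\sigma$ whenever $\sigma\subseteq\tau\in T$, and $\{A_\sigma:\sigma\in T_\alpha\}$ is a partition of $\omega$ for every $\alpha<\omega_1$. For $\alpha<\omega_1$ let $X_\alpha$ be the supremum in $\mathcal{P}(\omega\times\omega)/\mathcal{NC}$ of the countable family $\{\omega\times A_\sigma:\sigma\in T_\alpha\}$ (such a supremum exists). Then $\{X_\alpha:\alpha<\omega_1\}$ is an $\mathcal{NC}$-tower.
   Context: A tree $T\subseteq\omega^{<\omega_1}$ is a set of functions from countable ordinals to $\omega$ closed under restriction to smaller ordinals; $T_\alpha=\{\sigma\in T:\mathrm{dom}(\sigma)=\alpha\}$ is its $\alpha$-th level; $T$ is Aronszajn if $0<|T_\alpha|\leq\omega$ for all $\alpha<\omega_1$ and there is no $f:\omega_1\to\omega$ with $f\upharpoonright\alpha\in T$ for all $\alpha<\omega_1$. For $A\subseteq\omega\times\omega$ and $n<\omega$ let $A(n)=\{m:(n,m)\in A\}$; a family $\mathcal{X}\subseteq[\omega]^\omega$ is centered if every finite nonempty subfamily has infinite intersection. $\mathcal{NC}=\{A\subseteq\omega\times\omega:\ \text{for every } X\in[\omega]^\omega \text{ the family } \{A(n):n\in X\}\text{ is not centered}\}$, an ideal; $\mathcal{NC}^+$ is its complement in $\mathcal{P}(\omega\times\omega)$, and $A\subseteq_{\mathcal{NC}}B$ iff $A\setminus B\in\mathcal{NC}$.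 An $\mathcal{NC}$-tower is a subfamily of $\mathcal{NC}^+$ well-ordered by $\supseteq_{\mathcal{NC}}$ that has no lower bound in $\mathcal{NC}^+$ (no $C\in\mathcal{NC}^+$ with $C\subseteq_{\mathcal{NC}}X$ for all members $X$). *)

(* Defs.v *)
From HB Require Import structures.
From mathcomp Require Import all_boot all_order.
From mathcomp Require Import boolp classical_sets functions cardinality.
From mathcomp Require wochoice.
Set Implicit Arguments.
Unset Strict Implicit.
Unset Printing Implicit Defensive.
Import Order.TTheory.
Local Open Scope classical_set_scope.
Local Open Scope order_scope.

(* [W] has order type omega_1: an uncountable well-order all of whose proper
   initial segments are countable.  An element [a] of [W] plays the role of the
   countable ordinal [[set b | b < a]]. *)
Definition is_omega1 (d : Order.disp_t) (W : orderType d) : Prop :=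
  [/\ wochoice.well_order (<=%O : rel W),
      ~ countable [set: W]
    & forall a : W, countable [set b : W | b < a]].

Lemma omega1_exists :
  exists (d : Order.disp_t) (W : orderType d), is_omega1 W.
Proof.
have [R Rwo] := wochoice.well_ordering_principle (set nat).
have RwoT : wochoice.wo_chain R [pred x : set nat | true] by move=> A _; exact: Rwo.
have Rtot : total R by move=> x y; exact: (wochoice.wo_chainW RwoT).
have Ranti : antisymmetric R.
  by move=> x y; exact: (wochoice.wo_chain_antisymmetric RwoT).
have Rtr : transitive R.
  move=> y x z Rxy Ryz.
  have [|m [[Am Bm] _]] := Rwo [pred t | [|| t == x, t == y | t == z]].
    by exists x; rewrite inE eqxx.
  have mx : R m x by apply: Bm; rewrite inE eqxx.
  have my : R m y by apply: Bm; rewrite inE eqxx orbT.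
  have mz : R m z by apply: Bm; rewrite inE eqxx !orbT.
  move: Am; rewrite inE => /or3P[] /eqP E; subst m => //.
    by have <- : y = x by apply: Ranti; rewrite mx Rxy.
  by have <- : y = z by apply: Ranti; rewrite my Ryz.
pose seg x := [set y : set nat | R y x && (y != x)].
pose D := [pred x : set nat | `[< countable (seg x) >]].
pose W0 : choiceType := {x : set nat | D x}.
pose leW := fun x y : W0 => R (val x) (val y).
have leWanti : antisymmetric leW by move=> x y /Ranti /val_inj.
have leWtr : transitive leW by move=> x y z; exact: Rtr.
have leWtot : total leW by move=> x y; exact: Rtot.
pose W := HB.pack_for (orderType (Order.Disp tt tt)) (Choice.sort W0)
  (Order.isOrder.Build (Order.Disp tt tt) W0
    (fun _ _ => erefl) (fun _ _ => erefl) (fun _ _ => erefl)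
    leWanti leWtr leWtot).
exists (Order.Disp tt tt), W; split.
- apply: wochoice.antisymmetric_well_order.
    by move=> x y; apply: le_anti.
  move=> A [x Ax].
  have [|m [[Am Bm] _]] := Rwo [pred t | `[< exists2 u : W0, u \in A & val u = t >]].
    by exists (val x); apply/asboolP; exists x.
  move: Am => /asboolP[u uA um]; exists u; split=> // y yA.
  by rewrite /Order.le/= /leW um; apply: Bm; apply/asboolP; exists y.
- move=> cW.
  have cD : countable [set x | D x].
    have -> : [set x | D x] = [set val w | w in [set: W0]].
      apply/seteqP; split=> [x Dx|_ [w _ <-]]; last exact: (valP w).
      by exists (exist _ x Dx).
    exact: card_le_trans (card_image_le _ _) cW.
  have DT : forall x, D x.
    apply: contrapT => /existsNP[x0 nDx0].
    have [|m [[Am Bm] _]] := Rwo [pred t | ~~ D t].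
      by exists x0; rewrite inE; apply/negP.
    move: Am; rewrite inE => /negP; apply; apply/asboolP.
    apply: sub_countable cD; apply: subset_card_le => y /= /andP[Rym ym].
    apply: contrapT => /negP nDy; move/negP: ym; apply; apply/eqP/Ranti.
    by rewrite Rym Bm// inE.
  have : countable [set: set nat].
    by apply: sub_countable cD; apply: subset_card_le => x _; exact: DT.
  move=> /pcard_leP[f].
  pose B := [set n | forall S, f S = n -> ~ S n].
  have finj := @inj _ _ _ f.
  have BB : B (f B) -> ~ B (f B) by move=> h; exact: (h B).
  have nB : ~ B (f B) by move=> h; exact: (BB h h).
  apply: nB => S fS; have <- : B = S by apply: finj => //; rewrite ?in_setT.
  by move=> h; exact: (BB h h).
- move=> a; have /asboolP ca : D (val a) := valP a.
  have inja : {in [set b : W | b < a] &, injective (val : W -> set nat)}.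
    by move=> x y _ _ /val_inj.
  apply: sub_countable ca; rewrite -(card_le_eql (inj_card_eq inja)).
  apply: subset_card_le => _ [b /= ba <-] /=.
  have := ba; rewrite lt_def => /andP[nab lba]; apply/andP; split=> //.
  by apply: contraNN nab => /eqP/val_inj ->.
Qed.

Section Trees.
Context {d : Order.disp_t} {W : orderType d}.
Implicit Types (s t : W -> option nat) (a b : W) (T : set (W -> option nat)).

(* A partial function from [W] to omega is encoded as [s : W -> option nat];
   the elements of omega^{<omega_1} are those whose domain is the set of
   predecessors of some [a]. *)
Definition has_dom s a : Prop := forall b, s b <> None <-> b < a.

Definition restr s a : W -> option nat := fun b => if b < a then s b else None.

(* Inclusion of graphs. *)
Definition fun_sub s t : Prop := forall b n, s b = Some n -> t b = Some n.

Definition is_tree T : Prop :=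
  (forall s, T s -> exists a, has_dom s a) /\
  (forall s a b, T s -> has_dom s a -> b <= a -> T (restr s b)).

Definition level T a : set (W -> option nat) := [set s | T s /\ has_dom s a].

Definition aronszajn T : Prop :=
  [/\ is_tree T,
      forall a, level T a !=set0 /\ countable (level T a)
    & ~ exists f : W -> nat, forall a, T (restr (fun b => Some (f b)) a)].

End Trees.

Definition almost_sub (A B : set nat) : Prop := finite_set (A `\` B).

Definition centered (F : set (set nat)) : Prop :=
  (forall B, F B -> infinite_set B) /\
  (forall G : set (set nat), G `<=` F -> finite_set G -> G !=set0 ->
     infinite_set (\bigcap_(B in G) B)).

Definition NC : set (set (nat * nat)) :=
  [set A | forall X : set nat, infinite_set X ->
     ~ centered [set xsection A n | n in X]].

Definition NCplus : set (set (nat * nat)) := ~` NC.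

Definition nc_sub (A B : set (nat * nat)) : Prop := NC (A `\` B).

(* The class of [S] is the supremum, in P(omega x omega)/NC, of the classes of
   the members of [F]; this determines [S] only modulo NC. *)
Definition is_nc_sup (F : set (set (nat * nat))) (S : set (nat * nat)) : Prop :=
  (forall B, F B -> nc_sub B S) /\
  (forall U, (forall B, F B -> nc_sub B U) -> nc_sub S U).

(* [nc_sub] is only a preorder on sets, so "well-ordered" is understood for the
   induced order on classes modulo NC: each nonempty subfamily has a first
   (that is, largest modulo NC) member, unique up to NC-equivalence. *)
Definition nc_well_ordered (F : set (set (nat * nat))) : Prop :=
  forall G, G `<=` F -> G !=set0 ->
    exists2 X, G X & forall Y, G Y -> nc_sub Y X.

Definition nc_tower (F : set (set (nat * nat))) : Prop :=
  [/\ F `<=` NCplus,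
      nc_well_ordered F
    & ~ exists2 C, NCplus C & forall X, F X -> nc_sub C X].

(* Main.v *)
(** A set [A] is [NC]-positive iff some free ultrafilter [U] on omega contains
    infinitely many of the sections of [A].  Hence [A] is below [B] modulo [NC]
    iff, for every free [U], all but finitely many [n] with [A(n)] in [U] also
    have [B(n)] in [U].

    Enumerating a level as [s_0, s_1, ...], the set whose [n]-th section is the
    union of the [A_{s_i}], [i <= n], is a supremum of the [omega x A_{s_i}], and
    its sections lie in [U] only if some [A_{s_i}] does.  So if [C] is a positive
    lower bound of all the suprema, witnessed by [U], then [U] contains [A_s] for
    exactly one [s] on each level; these nodes cohere, since [A_t] in [U] implies
    [A_s] in [U] for [s] below [t], and thus form a cofinal branch of the
    Aronszajn tree. *)

Require Import Defs.
From HB Require Import structures.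
From mathcomp Require Import all_boot all_order.
From mathcomp Require Import boolp classical_sets functions cardinality filter.
From mathcomp Require wochoice.
Local Open Scope classical_set_scope.

(** * Ultrafilters and finite set operations *)

Lemma filter_bigcap_finite (T I : Type) (F : set_system T) (D : set I)
    (f : I -> set T) : Filter F -> finite_set D ->
  (forall i, D i -> F (f i)) -> F (\bigcap_(i in D) f i).
Proof.
move=> FF /(@finite_fsetP {classic I})[E ->] EF.
by apply: (@filter_bigI _ {classic I}) => i iE; exact: EF.
Qed.

Lemma ultra_setC {T : Type} {U : set_system T} (B : set T) :
  UltraFilter U -> U (~` B) <-> ~ U B.
Proof.
move=> UU; split=> [UCB UB|nUB]; last by case: (in_ultra_setVsetC B UU).
have : U (B `&` ~` B) by exact: filterI.
by rewrite setICr; exact: filter_not_empty.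
Qed.

Lemma ultra_setD {T : Type} {U : set_system T} (B C : set T) :
  UltraFilter U -> U (B `\` C) <-> U B /\ ~ U C.
Proof.
move=> UU; split=> [UBC|[UB nUC]]; last first.
  by apply: filterI => //; apply/ultra_setC.
split; first by apply: filterS UBC => x [].
by apply/ultra_setC; apply: filterS UBC => x [].
Qed.

Lemma ultra_bigcup_finite (T I : Type) (U : set_system T) (D : set I)
    (f : I -> set T) : UltraFilter U -> finite_set D ->
  U (\bigcup_(i in D) f i) -> exists2 i, D i & U (f i).
Proof.
move=> UU Dfin UDf; apply: contrapT => nUf.
suff /ultra_setC : U (~` (\bigcup_(i in D) f i)) by [].
rewrite setC_bigcup; apply: filter_bigcap_finite => // i Di.
by apply/ultra_setC => Ufi; apply: nUf; exists i.
Qed.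

(** * Free ultrafilters on omega *)

Definition free_ultra (U : set_system nat) : Prop :=
  UltraFilter U /\ forall B, U B -> infinite_set B.

Lemma free_ultra_almost_sub (U : set_system nat) (B C : set nat) :
  free_ultra U -> almost_sub B C -> U B -> U C.
Proof.
move=> [UU Uinf] BC UB; apply: contrapT => nUC.
by apply: (Uinf (B `\` C)) => //; apply/ultra_setD.
Qed.

(** The sets almost containing a finite intersection from [F] form a filter, proper because these
    intersections are infinite; any ultrafilter extending it works. *)
Lemma centered_free_ultra (F : set (set nat)) :
  centered F -> exists2 U, free_ultra U & F `<=` U.
Proof.
move=> [_ Fcap].
pose V := [set P | exists G : set (set nat),
  [/\ G `<=` F, finite_set G & almost_sub (\bigcap_(B in G) B) P]].
(* The empty subfamily has intersection omega, so it puts every cofinite set into [V]; this makes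
   the ultrafilters above [V] free. *)
have Vcof P : finite_set (~` P) -> V P.
  by move=> Pfin; exists set0; split=> //; apply: sub_finite_set Pfin => x [].
have FV : ProperFilter V.
  apply: Build_ProperFilter => [[G [GF Gfin]]|].
    rewrite /almost_sub setD0 => capfin.
    have [G0|/set0P GN0] := eqVneq G set0.
      by move: capfin; rewrite G0 bigcap_set0; exact: infinite_nat.
    exact: (Fcap G).
  split.
  - by apply: Vcof; rewrite setCT.
  - move=> P Q [G [GF Gfin GP]] [H [HF Hfin HQ]]; exists (G `|` H); split.
    + by move=> B [/GF|/HF].
    + by rewrite finite_setU.
    + have : finite_set ((\bigcap_(B in G) B `\` P) `|` (\bigcap_(B in H) B `\` Q)).
        by rewrite finite_setU.
      apply: sub_finite_set => x [GHx nPQx].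
      have [Px|nPx] := pselect (P x).
        by right; split=> [B HB|Qx]; [apply: GHx; right | exact: nPQx].
      by left; split=> // B GB; apply: GHx; left.
  - move=> P Q PQ [G [GF Gfin GP]]; exists G; split=> //.
    by apply: sub_finite_set GP => x [Gx nQx]; split=> // /PQ.
have [U [UU VU]] := ultraFilterLemma FV; exists U.
  split=> // B UB Bfin.
  suff /ultra_setC : U (~` B) by [].
  by apply: VU; apply: Vcof; rewrite setCK.
move=> B FB; apply: VU; exists [set B]; split=> //; first by move=> _ ->.
by rewrite /almost_sub bigcap_set1 setDv.
Qed.

Lemma infinite_free_ultra (B : set nat) :
  infinite_set B -> exists2 U, free_ultra U & U B.
Proof.
move=> Binf; have [|U Ufree BU] := @centered_free_ultra [set B].
  split=> [_ ->//|G GB _ [_ /[dup] /GB -> GBB]].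
  by apply: sub_infinite_set Binf => x Bx C /GB ->.
by exists U => //; exact: BU.
Qed.

(** * The ideal [NC] in terms of free ultrafilters *)

Lemma NCP (A : set (nat * nat)) :
  NC A <-> forall U, free_ultra U -> finite_set [set n | U (xsection A n)].
Proof.
split=> [NCA U [UU Uinf]|Afin X Xinf].
  (* Sections lying in one free [U] are centered, their finite intersections being in [U] and hence
     infinite. *)
  apply: contrapT => UAinf; apply: (NCA _ UAinf); split=> [_ [n UAn <-]|].
    exact: Uinf.
  move=> G GA Gfin _; apply: Uinf; apply: filter_bigcap_finite => // B GB.
  by have [n UAn <-] := GA _ GB.
case/centered_free_ultra => U /Afin UAfin XU; apply: Xinf.
by apply: sub_finite_set UAfin => n Xn; apply: XU; exists n.
Qed.

Lemma NCplusP (A : set (nat * nat)) :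
  NCplus A <->
  exists2 U, free_ultra U & infinite_set [set n | U (xsection A n)].
Proof.
split=> [nNC|[U Ufree Uinf] /NCP/(_ U Ufree)//].
apply: contrapT => nU; apply: nNC; apply/NCP => U Ufree.
by apply: contrapT => Uinf; apply: nU; exists U.
Qed.

Lemma nc_subP (A B : set (nat * nat)) :
  nc_sub A B <-> forall U, free_ultra U ->
    finite_set [set n | U (xsection A n) /\ ~ U (xsection B n)].
Proof.
rewrite /nc_sub; split=> [/NCP AB U Ufree|AB]; last apply/NCP => U Ufree.
  apply: sub_finite_set (AB U Ufree) => n /= UAB.
  by rewrite xsectionD; apply/ultra_setD => //; exact: Ufree.1.
apply: sub_finite_set (AB U Ufree) => n /=.
by rewrite xsectionD => /ultra_setD; apply; exact: Ufree.1.
Qed.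

Lemma nc_sub_trans (A B C : set (nat * nat)) :
  nc_sub A B -> nc_sub B C -> nc_sub A C.
Proof.
move=> /nc_subP AB /nc_subP BC; apply/nc_subP => U Ufree.
have := conj (AB U Ufree) (BC U Ufree); rewrite -finite_setU.
apply: sub_finite_set => n [An nCn].
by have [Bn|nBn] := pselect (U (xsection B n)); [right|left].
Qed.

(** Positivity passes upwards with the same witness [U], so a single ultrafilter can be followed
    through all levels of the tree. *)
Lemma nc_sub_infinite (A B : set (nat * nat)) (U : set_system nat) :
  nc_sub A B -> free_ultra U -> infinite_set [set n | U (xsection A n)] ->
  infinite_set [set n | U (xsection B n)].
Proof.
move=> /nc_subP AB Ufree Ainf Bfin; apply: Ainf.
have := conj (AB U Ufree) Bfin; rewrite -finite_setU.
apply: sub_finite_set => n An.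
by have [Bn|nBn] := pselect (U (xsection B n)); [right|left].
Qed.

Lemma NCplus_nc_sub (A B : set (nat * nat)) :
  nc_sub A B -> NCplus A -> NCplus B.
Proof.
move=> AB /NCplusP[U Ufree Ainf]; apply/NCplusP; exists U => //.
exact: nc_sub_infinite AB Ufree Ainf.
Qed.

(** * Cylinders and their countable suprema *)

Lemma xsection_setTX (B : set nat) (n : nat) :
  xsection ([set: nat] `*` B) n = B.
Proof. by rewrite in_xsectionX// in_setT. Qed.

Lemma nc_sub_setTX (B C : set nat) :
  almost_sub B C -> nc_sub ([set: nat] `*` B) ([set: nat] `*` C).
Proof.
move=> BC; apply/nc_subP => U Ufree.
rewrite (_ : [set n | _] = set0)//.
apply/seteqP; split=> // n /=; rewrite !xsection_setTX => -[UB]; apply.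
exact: free_ultra_almost_sub UB.
Qed.

Lemma NCplus_setTX (B : set nat) :
  infinite_set B -> NCplus ([set: nat] `*` B).
Proof.
move=> /infinite_free_ultra[U Ufree UB]; apply/NCplusP; exists U => //.
apply: (@sub_infinite_set _ [set: nat]); last exact: infinite_nat.
by move=> n _ /=; rewrite xsection_setTX.
Qed.

(** The last clause depends on the chosen representative [S], not only on its class modulo [NC]:
    enlarging one section to omega may destroy it. *)
Lemma nc_sup_countable (I : Type) (D : set I) (F : I -> set nat) :
  countable D -> exists S, is_nc_sup [set [set: nat] `*` F i | i in D] S /\
    forall U, free_ultra U -> forall n, U (xsection S n) ->
      exists2 i, D i & U (F i).
Proof.
move=> /countable_injP[e einj].
pose S := [set p : nat * nat | exists2 i, D i /\ (e i <= p.1)%N & F i p.2].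
have SE n : xsection S n = \bigcup_(i in [set i | D i /\ (e i <= n)%N]) F i.
  by apply/seteqP; split=> m; rewrite xsectionP.
have US U : free_ultra U -> forall n, U (xsection S n) ->
    exists2 i, D i & U (F i).
  move=> [UU Uinf] n; rewrite SE => /ultra_bigcup_finite[|i [Di _] UFi].
    set E := [set i | _].
    have Einj : {in E &, injective e}.
      by move=> i j; rewrite !inE => -[Di _] [Dj _]; apply: einj; rewrite inE.
    rewrite -(eq_finite_set (inj_card_eq Einj)).
    by apply: sub_finite_set (finite_II n.+1) => _ [i [_ ein] <-].
  by exists i.
exists S; split=> //; split=> [_ [i Di <-]|V FV]; apply/nc_subP => U Ufree.
  have UU := Ufree.1.
  apply: sub_finite_set (finite_II (e i)) => n /=.
  rewrite xsection_setTX => -[UFi nUS]; rewrite ltnNge; apply/negP => ein.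
  by apply: nUS; rewrite SE; apply: filterS UFi; exact: bigcup_sup.
(* A single section of [S] in [U] already puts some [F i] in [U]; then all sections of its cylinder
   are in [U], hence almost all sections of the upper bound [V]. *)
have [[n0 Un0]|nU] := pselect (exists n, U (xsection S n)).
  have [i Di UFi] := US _ Ufree _ Un0.
  have /nc_subP/(_ U Ufree) : nc_sub ([set: nat] `*` F i) V.
    by apply: FV; exists i.
  by apply: sub_finite_set => n [_ nVn]; rewrite /= xsection_setTX.
rewrite (_ : [set n | _] = set0)//.
by apply/seteqP; split=> // n [USn _]; apply: nU; exists n.
Qed.

(** * Nodes and branches of trees on omega_1 *)

Section Omega1Trees.
Context {d : Order.disp_t} {W : orderType d}.
Import Order.TTheory.
Local Open Scope order_scope.
Implicit Types (s t : W -> option nat) (a b : W) (T : set (W -> option nat)).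

Lemma well_order_min (P : set W) :
  wochoice.well_order (<=%O : rel W) -> P !=set0 ->
  exists2 a, P a & forall b, P b -> a <= b.
Proof.
move=> wo [x Px]; have [|a [[Pa amin] _]] := wo [pred w | `[< P w >]].
  by exists x; apply/asboolP.
exists a; first exact/asboolP.
by move=> b Pb; apply: amin; apply/asboolP.
Qed.

(** A maximum [a] would make [W] countable: code its predecessors by successors, which leaves 0 for
    [a] itself. *)
Lemma omega1_unbounded : is_omega1 W -> forall a, exists b, a < b.
Proof.
move=> [_ nW cW] a; apply: contrapT => amax; apply: nW.
have lea b : b <= a by rewrite leNgt; apply/negP => ab; apply: amax; exists b.
have /countable_injP[e einj] := cW a; apply/countable_injP.
exists (fun b => if b < a then (e b).+1 else 0%N) => b c _ _ /=.
have [ba|ab] := ltP b a; have [ca|ac] := ltP c a => //.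
  by case; apply: einj; rewrite inE.
by move=> _; apply: le_anti; rewrite (le_trans (lea b) ac) (le_trans (lea c) ab).
Qed.

Lemma has_dom_restr s a b : has_dom s a -> b <= a -> has_dom (restr s b) b.
Proof.
move=> sa ba c; rewrite /restr; case: ifP => // cb; split=> // _.
by apply/sa; exact: lt_le_trans ba.
Qed.

Lemma level_restr T s a b :
  is_tree T -> level T a s -> b <= a -> level T b (restr s b).
Proof.
move=> [_ Trestr] [Ts sa] ba; split; first exact: Trestr sa ba.
exact: has_dom_restr sa ba.
Qed.

Lemma fun_sub_restr s a : fun_sub (restr s a) s.
Proof. by move=> b n; rewrite /restr; case: ifP. Qed.

Lemma coherent_nodes_branch T (g : W -> W -> option nat) :
  (forall a, exists b, a < b) ->
  (forall a, level T a (g a)) ->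
  (forall a b, a <= b -> restr (g b) a = g a) ->
  exists f : W -> nat, forall a, T (restr (fun b => Some (f b)) a).
Proof.
move=> Wunb gT gcoh; have [up upP] := choice Wunb.
(* The node at [up b] is defined at [b] since [b < up b], so the default 0 is never taken; by
   coherence any node above level [b] gives the same value. *)
exists (fun b => odflt 0%N (g (up b) b)) => a.
suff -> : restr (fun b => Some (odflt 0%N (g (up b) b))) a = g a.
  exact: (gT a).1.
have gE b c e : b < c -> c <= e -> g e b = g c b.
  by move=> bc ce; rewrite -(gcoh _ _ ce) /restr bc.
apply/funext => b; rewrite /restr; case: ifPn => [ba|nba].
  have -> : g (up b) b = g a b.
    by have [ca|ac] := leP (up b) a; [rewrite (gE b _ _ _ ca)|
       rewrite (gE b _ _ ba (ltW ac))].
  by have := ((gT a).2 b).2 ba; case: (g a b).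
apply/esym; apply: contrapT => /((gT a).2 b).1.
by move/negP: nba.
Qed.

End Omega1Trees.

Theorem theorem2p10 (d : Order.disp_t) (W : orderType d) (hW : is_omega1 W)
  (T : set (W -> option nat)) (hT : aronszajn T)
  (A : (W -> option nat) -> set nat)
  (hinf : forall s, T s -> infinite_set (A s))
  (hsub : forall s t, T s -> T t -> fun_sub s t -> almost_sub (A t) (A s))
  (hpart : forall a : W, partition (level T a) A [set: nat]) :
  (forall a : W, exists S : set (nat * nat),
     is_nc_sup [set [set: nat] `*` A s | s in level T a] S) /\
  (forall X : W -> set (nat * nat),
     (forall a : W, is_nc_sup [set [set: nat] `*` A s | s in level T a] (X a)) ->
     nc_tower (range X)).
Proof.
have [Ttree Tlev Tbranch] := hT; have [Wwo _ _] := hW.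
have supT a := nc_sup_countable _ _ A (Tlev a).2.
split=> [a|X Xsup]; first by have [S [Ssup _]] := supT a; exists S.
have restrA a b s : (a <= b)%O -> level T b s -> almost_sub (A s) (A (restr s a)).
  move=> ab sb; have [Ts _] := sb; have [Tr _] := level_restr _ _ _ _ Ttree sb ab.
  by apply: hsub => //; exact: fun_sub_restr.
split.
- move=> _ [a _ <-]; have [[s sa] _] := Tlev a.
  apply: (@NCplus_nc_sub ([set: nat] `*` A s)).
    by apply: (Xsup a).1; exists s.
  by apply: NCplus_setTX; apply: hinf; exact: sa.1.
- move=> G GX [Y0 GY0]; have [a0 _ Xa0] := GX _ GY0.
  (* The least index occurring in [G] gives its largest member: each cylinder of a later level lies
     below that of the restricted node. *)
  have [|a GXa amin] := @well_order_min _ _ [set a | G (X a)] Wwo.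
    by exists a0; rewrite /= Xa0.
  exists (X a) => // Y GY; have [b _ Xb] := GX _ GY.
  have ab : (a <= b)%O by apply: amin; rewrite /= Xb.
  rewrite -Xb; apply: (Xsup b).2 => _ [s sb <-].
  apply: nc_sub_trans (nc_sub_setTX _ _ (restrA _ _ _ ab sb)) _.
  by apply: (Xsup a).1; exists (restr s a) => //; exact: level_restr sb ab.
- case=> C /NCplusP[U Ufree Cinf] CX.
  have UU := Ufree.1.
  have nodeU a : exists s, level T a s /\ U (A s).
    (* [X a] is an arbitrary supremum, so pass to the equivalent [S], where one section in [U]
       yields a node. *)
    have [S [Ssup US]] := supT a.
    have CS : nc_sub C S.
      by apply: (@nc_sub_trans _ (X a)); [apply: CX | apply: (Xsup a).2; exact: Ssup.1].
    have /infinite_setN0[n Sn] := nc_sub_infinite _ _ _ CS Ufree Cinf.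
    by have [s sa UAs] := US _ Ufree _ Sn; exists s.
  have [g gP] := choice nodeU.
  apply: Tbranch; apply: (coherent_nodes_branch _ g) => [||a b ab].
  + exact: omega1_unbounded hW.
  + by move=> a; exact: (gP a).1.
  + have [gb UAb] := gP b; have [ga UAa] := gP a.
    have [_ Atriv _] := hpart a.
    (* Both nodes lie on level [a] and both their sets are in [U], so the sets meet; distinct nodes
       of a level have disjoint sets. *)
    apply: Atriv => //; first exact: level_restr gb ab.
    apply: (@filter_ex _ U); apply: filterI => //.
    exact: free_ultra_almost_sub Ufree (restrA _ _ _ ab gb) UAb.
Qed.
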